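(* Let $G$ be a compact topological group and let $L$ be a Banach $G$-space. Then $cc(L)$, with the Hausdorff metric topology and the induced action $(g,A)\mapsto gA=\{ga\mid a\in A\}$, is a $G$-$\mathrm{AE}$. Additionally, if the induced action $(g,A)\mapsto gA$ of $G$ on $CB(L)$ is continuous, then $CB(L)$ is also a $G$-$\mathrm{AE}$.
   Context: A Banach $G$-space is a real Banach space $L$ with a continuous action $G\times L\to L$ that is linear ($g(\alpha x+\beta y)=\alpha(gx)+\beta(gy)$ for all $g\in G$, $\alpha,\beta\in\mathbb R$, $x,y\in L$) and whose norm is $G$-invariant ($\|gx\|=\|x\|$ for all $g\in G$, $x\in L$). $CB(L)$ denotes the set of all nonempty closed bounded convex subsets of $L$, with the Hausdorff metric $d_H(A,B)=\inf\{\varepsilon>0\mid A\subset N(B,\varepsilon),\ B\subset N(A,\varepsilon)\}$, where $N(A,\varepsilon)=\{x\in L\mid d(x,A)<\varepsilon\}$ and $d$ is the metric induced by the norm; $cc(L)$ is the subspace of $CB(L)$ consisting of the nonempty compact convex subsets of $L$. The induced action of $G$ on $cc(L)$ is always continuous, while on $CB(L)$ it need not be. A $G$-space is a topological space with a continuous action of $G$. A map is a continuous function; a map $f$ between $G$-spaces is equivariant if $f(gx)=gf(x)$ for all $g,x$. A metrizable $G$-space $X$ is a $G$-equivariant absolute extensor ($G$-$\mathrm{AE}$) if for every metrizable $G$-space $Z$ and every equivariant map $f:A\to X$ from a closed $G$-invariant subset $A\subset Z$, there exists an equivariant map $F:Z\to X$ with $F|_A=f$. *)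

(* Defs.v *)
From HB Require Import structures.
From mathcomp Require Import all_boot all_order all_algebra.
From mathcomp Require Import all_classical all_reals all_analysis.

Set Implicit Arguments.
Unset Strict Implicit.
Unset Printing Implicit Defensive.

Import Order.TTheory GRing.Theory Num.Theory.
Import numFieldNormedType.Exports.

Local Open Scope classical_set_scope.
Local Open Scope ring_scope.

HB.mixin Record isTopologicalGroup G of Group G & Topological G := {
  mulg_continuous : continuous (fun p : G * G => (p.1 * p.2)%g) ;
  invg_continuous : continuous (fun g : G => (g^-1)%g)
}.

(* No separation axiom is required: topological groups need not be Hausdorff. *)
#[short(type="topologicalGroupType")]
HB.structure Definition TopologicalGroup :=
  {G of Group G & Topological G & isTopologicalGroup G}.

Definition metrizable (R : realType) (T : topologicalType) : Prop :=
  exists d : T -> T -> R,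
    [/\ forall x y, d x y = 0 <-> x = y,
        forall x y, d x y = d y x,
        forall x y z, d x z <= d x y + d y z &
        forall x (U : set T),
          nbhs x U <-> exists2 e, 0 < e & [set y | d x y < e] `<=` U].

Section actions.
Context {G : topologicalGroupType}.

Definition is_action (X : Type) (a : G -> X -> X) : Prop :=
  (forall x, a 1%g x = x) /\ (forall g h x, a (g * h)%g x = a g (a h x)).

Definition continuous_action (X : topologicalType) (a : G -> X -> X) : Prop :=
  continuous (fun p : G * X => a p.1 p.2).

Definition Gspace (X : topologicalType) (a : G -> X -> X) : Prop :=
  is_action a /\ continuous_action a.

Definition invariant (X : Type) (a : G -> X -> X) (A : set X) : Prop :=
  forall g x, A x -> A (a g x).

Definition equivariant (X Y : Type) (aX : G -> X -> X) (aY : G -> Y -> Y)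
    (f : X -> Y) : Prop :=
  forall g x, f (aX g x) = aY g (f x).

Lemma restr_act_subproof (X : Type) (a : G -> X -> X) (A : set X) :
  invariant a A -> forall g (x : A), a g (set_val x) \in A.
Proof. by move=> iA g x; apply/mem_set/iA/set_valP. Qed.

Definition restr_act (X : Type) (a : G -> X -> X) (A : set X)
    (iA : invariant a A) (g : G) (x : A) : A :=
  SigSub (restr_act_subproof iA g x).

(* The subset A is used as a type, with its subspace topology. *)
Definition G_AE (R : realType) (X : topologicalType) (aX : G -> X -> X) : Prop :=
  [/\ metrizable R X, Gspace aX &
      forall (Z : topologicalType) (aZ : G -> Z -> Z),
        metrizable R Z -> Gspace aZ ->
        forall (A : set Z) (iA : invariant aZ A) (f : A -> X),
          closed A -> continuous f -> equivariant (restr_act iA) aX f ->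
          exists F : Z -> X,
            [/\ continuous F, equivariant aZ aX F &
                forall z : A, F (set_val z) = f z]].

End actions.

Record banachGaction (G : topologicalGroupType) (R : realType)
    (L : completeNormedModType R) := BanachGaction {
  bact :> G -> L -> L ;
  bact_Gspace : Gspace bact ;
  bact_linear : forall g (k l : R) (x y : L),
    bact g (k *: x + l *: y) = k *: bact g x + l *: bact g y ;
  bact_norm : forall g x, `|bact g x| = `|x|
}.

Section hausdorff_metric.
Context {R : realType} {L : completeNormedModType R}.
Implicit Types (A B C : set L) (x y : L) (e : R).

Definition set_dist x A : R := inf [set `|x - a| | a in A].

Definition enlargement A e : set L := [set x | set_dist x A < e].

Definition hausdorff_dist A B : R :=
  inf [set e | [/\ 0 < e, A `<=` enlargement B e & B `<=` enlargement A e]].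

Lemma set_dist_has_inf x A : A !=set0 -> has_inf [set `|x - a| | a in A].
Proof.
move=> [a Aa]; split; first by exists `|x - a|, a.
by exists 0 => _ [b _ <-].
Qed.

Lemma enlargementP A e x : A !=set0 ->
  enlargement A e x <-> exists2 a, A a & `|x - a| < e.
Proof.
move=> A0; split.
  by move=> /(inf_lt (proj1 (set_dist_has_inf x A0)))[_ [a Aa <-] ?]; exists a.
move=> [a Aa]; apply: le_lt_trans; apply: ge_inf; last by exists a.
by exists 0 => _ [b _ <-].
Qed.

End hausdorff_metric.

Record CB (R : realType) (L : completeNormedModType R) := MkCB {
  cb_set :> set L ;
  cb_setP : [/\ cb_set !=set0, closed cb_set, bounded_set cb_set &
                convex_set cb_set]
}.

Section CB_metric.
Context {R : realType} {L : completeNormedModType R}.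
Implicit Types A B C : CB L.

Lemma CB_eq A B : cb_set A = cb_set B -> A = B.
Proof.
case: A B => [A pA] [B pB] /= AB; case: _ / AB in pB *.
by congr MkCB; exact: Prop_irrelevance.
Qed.

Definition hset A B : set R :=
  [set e | [/\ 0 < e, A `<=` enlargement B e & B `<=` enlargement A e]].

Lemma CB_nonempty A : cb_set A !=set0. Proof. by case: (cb_setP A). Qed.
Hint Resolve CB_nonempty : core.

Lemma hset_has_inf A B : has_inf (hset A B).
Proof.
split; last by exists 0 => e [/ltW].
have [[a0 Aa0] _ bA _] := cb_setP A; have [[b0 Bb0] _ bB _] := cb_setP B.
have bound (S : set L) : bounded_set S ->
    exists2 M : R, 0 <= M & forall x, S x -> `|x| <= M.
  move=> [M [_ SM]]; exists (`|M| + 1); first by rewrite addr_ge0.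
  by apply: SM; apply: (le_lt_trans (ler_norm M)); rewrite ltrDl.
have [M M0 AM] := bound _ bA; have [N N0 BN] := bound _ bB.
exists (M + N + 1); split.
- by rewrite ltr_wpDl// addr_ge0.
- move=> a Aa; apply/enlargementP => //; exists b0 => //.
  rewrite (le_lt_trans (ler_normB _ _))// ltr_pwDr// lerD//.
    exact: AM.
  exact: BN.
- move=> b Bb; apply/enlargementP => //; exists a0 => //.
  rewrite (le_lt_trans (ler_normB _ _))// ltr_pwDr// addrC lerD//.
    exact: AM.
  exact: BN.
Qed.

Lemma hset_refl A e : 0 < e -> hset A A e.
Proof.
by move=> e0; split=> // x Ax; apply/enlargementP => //; exists x;
  rewrite ?subrr ?normr0.
Qed.

Lemma hdist_ge0 A B : 0 <= hausdorff_dist A B.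
Proof.
by apply: lb_le_inf => [|e [/ltW]]//; case: (hset_has_inf A B).
Qed.

Lemma hausdorff_distxx A : hausdorff_dist A A = 0.
Proof.
apply/eqP; rewrite eq_le hdist_ge0 andbT; apply/ler_addgt0Pl => e e0.
rewrite addr0; apply: ge_inf; last exact: hset_refl.
by exists 0 => ? [/ltW].
Qed.

Lemma hausdorff_dist_sym A B : hausdorff_dist A B = hausdorff_dist B A.
Proof.
by congr inf; apply/seteqP; split=> e [].
Qed.

Lemma hdist_lt A B e : hausdorff_dist A B < e ->
  forall a, cb_set A a -> exists2 b, cb_set B b & `|a - b| < e.
Proof.
move=> /(inf_lt (proj1 (hset_has_inf A B)))[d [_ AB _] de] a /AB.
by move=> /enlargementP-/(_ (CB_nonempty B))[b Bb abd]; exists b => //; exact: lt_trans de.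
Qed.

Lemma hausdorff_dist_positivity A B : hausdorff_dist A B = 0 -> A = B.
Proof.
suff H C (D : CB L) : hausdorff_dist C D = 0 -> cb_set C `<=` D.
  by move=> AB0; apply/CB_eq/seteqP; split; apply: H;
    rewrite // hausdorff_dist_sym.
move=> CD0 x Cx; have [_ cD _ _] := cb_setP D.
apply: cD => U /nbhs_ballP[e /= e0 xeU].
have [|y Dy xye] := hdist_lt (A := C) (B := D) (e := e) _ Cx; first by rewrite CD0.
by exists y; split => //; apply: xeU; rewrite -ball_normE.
Qed.

Lemma hausdorff_dist_triangle B A C :
  hausdorff_dist A C <= hausdorff_dist A B + hausdorff_dist B C.
Proof.
apply/ler_addgt0Pl => e e0.
have e2 : 0 < e / 2 by rewrite divr_gt0.
rewrite [e]splitr addrACA.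
set r := e / 2 + _; set s := e / 2 + _.
have rP : hausdorff_dist A B < r by rewrite ltrDr.
have sP : hausdorff_dist B C < s by rewrite ltrDr.
apply: ge_inf; first by exists 0 => ? [/ltW].
split; first by rewrite addr_gt0// ltr_pwDl ?hdist_ge0.
- move=> a /(hdist_lt rP)[b /(hdist_lt sP)[c Cc bc] ab].
  apply/enlargementP => //; exists c => //.
  by rewrite (le_lt_trans (ler_distD b _ _))// ltrD.
- rewrite hausdorff_dist_sym in rP; rewrite hausdorff_dist_sym in sP.
  move=> c /(hdist_lt sP)[b /(hdist_lt rP)[a Aa ba] cb].
  apply/enlargementP => //; exists a => //.
  by rewrite (le_lt_trans (ler_distD b _ _))// addrC ltrD.
Qed.

HB.instance Definition _ := gen_eqMixin (CB L).
HB.instance Definition _ := gen_choiceMixin (CB L).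
HB.instance Definition _ := isMetric.Build R (CB L)
  hausdorff_distxx hausdorff_dist_positivity hausdorff_dist_sym
  hausdorff_dist_triangle.

End CB_metric.

(* Used as the type [set_type (cc L)], with the subspace topology of CB(L).
   Compact sets are closed and bounded, so no compact convex set is missed. *)
Definition cc (R : realType) (L : completeNormedModType R) : set (CB L) :=
  [set A | compact (cb_set A)].
Arguments cc {R} L.

Section induced_action.
Context {G : topologicalGroupType} {R : realType} {L : completeNormedModType R}.
Variable a : banachGaction G L.

Lemma bactK g : cancel (a g) (a g^-1%g).
Proof.
by move=> x; have [[a1 aM] _] := bact_Gspace a; rewrite -aM mulVg a1.
Qed.

Lemma bactVK g : cancel (a g^-1%g) (a g).
Proof.
by move=> x; have [[a1 aM] _] := bact_Gspace a; rewrite -aM mulgV a1.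
Qed.

Lemma bact_continuous g : continuous (a g).
Proof.
have [_ ca] := bact_Gspace a => x.
apply: (continuous_comp (f := fun x : L => (g, x))
  (g := fun p : G * L => a p.1 p.2)); last exact: ca.
by apply: cvg_pair; [exact: cvg_cst|exact: cvg_id].
Qed.

Lemma bact_image g (A : set L) : a g @` A = a g^-1%g @^-1` A.
Proof.
apply/seteqP; split=> [_ [x Ax <-]|y Ay] /=; first by rewrite bactK.
by exists (a g^-1%g y) => //; exact: bactVK.
Qed.

Lemma CB_act_subproof g (A : CB L) :
  [/\ a g @` A !=set0, closed (a g @` A), bounded_set (a g @` A) &
      convex_set (a g @` A)].
Proof.
have [[x Ax] cA [M [Mr bA]] vA] := cb_setP A; split.
- by exists (a g x), x.
- rewrite bact_image; apply: preimage_closed => // ? _; exact: bact_continuous.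
- exists M; split=> // N MN _ [y Ay <-] /=; rewrite bact_norm; exact: bA.
- move=> _ _ k /set_mem[y Ay <-] /set_mem[z Az <-]; apply/mem_set.
  eexists; first exact/set_mem/(vA y z k (mem_set Ay) (mem_set Az)).
  exact: bact_linear.
Qed.

Definition CB_act (g : G) (A : CB L) : CB L := MkCB (CB_act_subproof g A).

Lemma cc_invariant : invariant CB_act (cc L).
Proof.
move=> g A cA; apply: continuous_compact => //.
by apply: continuous_subspaceT; exact: bact_continuous.
Qed.

Definition cc_act : G -> cc L -> cc L := restr_act cc_invariant.

End induced_action.

(* Main.v *)
Require Import Defs.
From HB Require Import structures.
From mathcomp Require Import all_boot all_order all_algebra.
From mathcomp Require Import all_classical all_reals all_analysis.
From mathcomp Require Import wochoice ring lra.

Set Implicit Arguments.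
Unset Strict Implicit.
Unset Printing Implicit Defensive.

Import Order.TTheory GRing.Theory Num.Theory.
Import numFieldNormedType.Exports.

Local Open Scope classical_set_scope.
Local Open Scope ring_scope.

(* Hulls replace both Haar integration and partitions of unity.  A map F from
   a metrizable G-space Z into CB(L) is made equivariant by
   z |-> closed convex hull of the union over g of g^-1 F(g z): the hull is
   1-Lipschitz for the sup metric on families of sets, so this is continuous
   when G is compact, it keeps the values where F is already equivariant, and
   the hull of a compact family of compact sets is compact (Mazur).  It remains
   to extend f : A -> CB(L) without equivariance, following Dugundji: by
   Stone's argument the complement of A is covered by countably many layers,
   each a discrete union of pieces to which a nearby point of A is attached,
   and F is an iterated Minkowski combination, one level per layer, of the
   values of f at the attached points. *)

(** * Convex, bounded and compact sets in a Banach space *)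

Section normed_sets.
Context {R : realType} {L : completeNormedModType R}.
Implicit Types (S : set L) (x y : L).

Lemma convex_setP S : convex_set S <->
  forall x y (k : R), 0 <= k <= 1 -> S x -> S y -> S (k *: x + (1 - k) *: y).
Proof.
split=> [cS x y k /andP[k0 k1] Sx Sy|cS x y k /set_mem Sx /set_mem Sy].
  by have /set_mem := cS x y (Itv01 k0 k1) (mem_set Sx) (mem_set Sy).
apply/mem_set; apply: (cS x y k%:num) => //; apply/andP; split.
  exact: ge0.
exact: le1.
Qed.

Lemma closure_normP S x :
  closure S x <-> forall e, 0 < e -> exists2 y, S y & `|x - y| < e.
Proof.
split=> [cSx e e0|Sx U /nbhs_ballP[e /= e0 eU]].
  have [y [Sy]] := cSx _ (nbhsx_ballx x e e0).
  by rewrite -ball_normE /= => ?; exists y.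
have [y Sy xy] := Sx _ e0.
by exists y; split => //; apply: eU; rewrite -ball_normE.
Qed.

Lemma bounded_set_normP S :
  bounded_set S <-> exists M, forall x, S x -> `|x| <= M.
Proof.
split=> [[M [_ SM]]|[M SM]].
  by exists (M + 1); apply: SM; rewrite ltrDl.
exists M; split; first exact: num_real.
by move=> N /ltW MN x /SM /= /le_trans; apply.
Qed.

Lemma norm_conv_lt (x x' y y' : L) (t e : R) : 0 <= t <= 1 ->
  `|x - x'| < e -> `|y - y'| < e ->
  `|(t *: x + (1 - t) *: y) - (t *: x' + (1 - t) *: y')| < e.
Proof.
move=> /andP[t0 t1] xx yy.
rewrite opprD addrACA -!scalerBr.
apply: (le_lt_trans (ler_normD _ _)); rewrite !normrZ.
rewrite (ger0_norm t0) (@ger0_norm _ (1 - t)) ?subr_ge0//.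
(* Strictness comes from the first term, except at [t = 0], where only the second term is left. *)
have [->|t_neq0] := eqVneq t 0; first by rewrite mul0r add0r subr0 mul1r.
rewrite [e in _ < e](_ : _ = t * e + (1 - t) * e); last first.
  by rewrite -mulrDl addrC subrK mul1r.
apply: ltr_leD; first by rewrite ltr_pM2l// lt_def t_neq0.
by rewrite ler_wpM2l ?subr_ge0// ltW.
Qed.

Lemma convex_closure S : convex_set S -> convex_set (closure S).
Proof.
move=> /convex_setP cS; apply/convex_setP => x y k k01.
move=> /closure_normP Sx /closure_normP Sy; apply/closure_normP => e e0.
have [x' Sx' xx'] := Sx _ e0; have [y' Sy' yy'] := Sy _ e0.
by exists (k *: x' + (1 - k) *: y'); [exact: cS | exact: norm_conv_lt].
Qed.

Lemma bounded_closure S : bounded_set S -> bounded_set (closure S).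
Proof.
move=> /bounded_set_normP[M SM]; apply/bounded_set_normP; exists (M + 1).
move=> x /closure_normP/(_ 1 ltr01)[y /SM yM xy].
by rewrite -(subrK y x) (le_trans (ler_normD _ _))// addrC lerD// ltW.
Qed.

(* A closed set that stays within every [e] of some compact set is totally
   bounded, hence compact: an ultrafilter on it must contain a ball of each
   radius, so it is Cauchy. *)
Lemma compact_approx S : closed S ->
  (forall e, 0 < e -> exists2 K, compact K &
     forall x, S x -> exists2 y, K y & `|x - y| < e) ->
  compact S.
Proof.
move=> clS app; rewrite compact_ultra => F UF FS.
suff Fball e : 0 < e -> exists x, F (ball x e).
  have cF : cauchy F.
    by apply: cauchy_exP => e e0; exact: Fball.
  have /cvg_ex[p Fp] : cvg F by apply: cauchy_cvg.
  exists p; split => //.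
  apply: clS => U /Fp FU.
  exact: (@filter_ex _ F _ _ (filterI FS FU)).
move=> e0; have e2 : 0 < e / 2 by rewrite divr_gt0.
have [K cK SK] := app _ e2.
apply: contrapT => /forallNP nF.
(* If [F] contains no ball of radius [e], it contains all their complements; compactness of [K] then
   makes [F]-many points stay [e / 2] away from all of [K], against the choice of [K]. *)
have FK : \forall y \near F, K `<=` [set x | e / 2 <= `|y - x|].
  apply: (proj1 (compact_near_coveringP K) cK) => x Kx.
  have [//|Fc] := in_ultra_setVsetC (ball x e) UF; first by have := nF x.
  exists (ball x (e / 2), ~` ball x e); first by split => //; exact: nbhsx_ballx.
  move=> [x' y] /= []; rewrite -!ball_normE/= => xx' /negP; rewrite -leNgt => xy.
  by have := ler_distD x' x y; rewrite (distrC x' y) => h; lra.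
have [y [Sy Ky]] := @filter_ex _ F _ _ (filterI FS FK).
have [k /Ky /= + ky] := SK _ Sy; by rewrite leNgt ky.
Qed.

End normed_sets.

(** * Working criteria for the Hausdorff distance and its topology *)

Section hausdorff_distance.
Context {R : realType} {L : completeNormedModType R}.
Implicit Types (A B C X Y : CB L) (e t : R).

Lemma cb_closed A : closed A. Proof. by case: (cb_setP A). Qed.

Lemma cb_bounded A : exists M, forall x, cb_set A x -> `|x| <= M.
Proof. by apply/bounded_set_normP; case: (cb_setP A). Qed.

Lemma cb_convex A x y t : 0 <= t <= 1 -> cb_set A x -> cb_set A y ->
  cb_set A (t *: x + (1 - t) *: y).
Proof. by move: x y t; apply/convex_setP; case: (cb_setP A). Qed.

(** Closeness is asked for every [d] above [e], since distances to a closed set need not be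
    attained. *)
Lemma hausdorff_dist_le A B e : 0 <= e ->
  (forall d, e < d ->
    (forall x, cb_set A x -> exists2 y, cb_set B y & `|x - y| < d) /\
    (forall x, cb_set B x -> exists2 y, cb_set A y & `|x - y| < d)) ->
  hausdorff_dist A B <= e.
Proof.
move=> e0 AB; apply/ler_addgt0Pr => d d0.
have ed : e < e + d by rewrite ltrDl.
have [AB1 BA1] := AB _ ed.
apply: ge_inf; first by exists 0 => ? [/ltW].
split; first exact: le_lt_trans ed.
  by move=> x /AB1 ?; apply/enlargementP => //; exact: CB_nonempty.
by move=> x /BA1 ?; apply/enlargementP => //; exact: CB_nonempty.
Qed.

Lemma nbhs_CBP (A : CB L) (U : set (CB L)) :
  nbhs A U <-> exists2 e, 0 < e & forall B, hausdorff_dist A B < e -> U B.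
Proof.
split=> [/nbhs_ballP[e e0 eU]|[e e0 eU]]; first by exists e.
by apply/nbhs_ballP; exists e.
Qed.

Lemma near_CB_lt (A : CB L) e : 0 < e ->
  \forall B \near A, hausdorff_dist A (B : CB L) < e.
Proof. by move=> e0; apply/nbhs_CBP; exists e. Qed.

Lemma cvg_CBP (T : Type) (F : set_system T) (FF : Filter F) (f : T -> CB L) A :
  f @ F --> A <->
  forall e, 0 < e -> \forall x \near F, hausdorff_dist A (f x) < e.
Proof.
split=> [fA e e0|fA U /nbhs_CBP[e e0 eU]].
  exact: (fA _ (near_CB_lt A e0)).
by apply: filterS (fA _ e0) => x /eU.
Qed.

End hausdorff_distance.

(** * Convex combinations of closed bounded convex sets *)

Section minkowski_combination.
Context {R : realType} {L : completeNormedModType R}.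
Implicit Types (A B C D : CB L) (e s t : R).

Definition mix_set t A B : set L :=
  [set t *: p.1 + (1 - t) *: p.2 | p in cb_set A `*` cb_set B].

Lemma mix_subproof t A B :
  [/\ closure (mix_set t A B) !=set0, closed (closure (mix_set t A B)),
      bounded_set (closure (mix_set t A B)) &
      convex_set (closure (mix_set t A B))].
Proof.
split; last 1 first.
- apply/convex_closure/convex_setP.
  move=> _ _ k k01 [[x y] [/= Ax By] <-] [[x' y'] [/= Ax' By'] <-].
  exists (k *: x + (1 - k) *: x', k *: y + (1 - k) *: y').
    by split; exact: cb_convex.
  rewrite /= !scalerDr !scalerA addrACA.
  by rewrite (mulrC t) (mulrC t) (mulrC (1 - t)) (mulrC (1 - t)).
- have [[x Ax] [y By]] := (CB_nonempty A, CB_nonempty B).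
  by exists (t *: x + (1 - t) *: y); apply: subset_closure; exists (x, y).
- exact: closed_closure.
- apply: bounded_closure; apply/bounded_set_normP.
  have [[M AM] [N BN]] := (cb_bounded A, cb_bounded B).
  exists (`|t| * M + `|1 - t| * N) => _ [[x y] [/= Ax By] <-].
  rewrite (le_trans (ler_normD _ _))// !normrZ.
  by rewrite lerD// ler_wpM2l//; [exact: AM | exact: BN].
Qed.

(** The closure is taken because a Minkowski sum of closed bounded sets need not be closed in
    infinite dimension. *)
Definition mix t A B : CB L := MkCB (mix_subproof t A B).

Lemma mixP t A B x : cb_set (mix t A B) x <->
  forall e, 0 < e -> exists a b, [/\ cb_set A a, cb_set B b &
    `|x - (t *: a + (1 - t) *: b)| < e].
Proof.
split=> [/closure_normP xP e /xP[_ [[a b] [/= Aa Bb] <-]]|xP].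
  by exists a, b.
apply/closure_normP => e /xP[a [b [Aa Bb xe]]].
by exists (t *: a + (1 - t) *: b) => //; exists (a, b).
Qed.

Lemma mix0 A B : mix 0 A B = B.
Proof.
apply/CB_eq/seteqP; split=> x.
  move=> /mixP xP; apply/cb_closed/closure_normP => e /xP[a [b [_ Bb]]].
  by rewrite scale0r add0r subr0 scale1r; exists b.
move=> Bx; apply/mixP => e e0; have [a Aa] := CB_nonempty A.
by exists a, x; split=> //; rewrite scale0r add0r subr0 scale1r subrr normr0.
Qed.

Lemma mix1 A B : mix 1 A B = A.
Proof.
apply/CB_eq/seteqP; split=> x.
  move=> /mixP xP; apply/cb_closed/closure_normP => e /xP[a [b [Aa _]]].
  by rewrite subrr scale0r addr0 scale1r; exists a.
move=> Ax; apply/mixP => e e0; have [b Bb] := CB_nonempty B.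
by exists x, b; split=> //; rewrite subrr scale0r addr0 scale1r subrr normr0.
Qed.

Lemma mixxx t A : 0 <= t <= 1 -> mix t A A = A.
Proof.
move=> t01; apply/CB_eq/seteqP; split=> x.
  move=> /mixP xP; apply/cb_closed/closure_normP => e /xP[a [b [Aa Ab xe]]].
  by exists (t *: a + (1 - t) *: b) => //; exact: cb_convex.
move=> Ax; apply/mixP => e e0; exists x, x; split=> //.
by rewrite -scalerDl subrKC scale1r subrr normr0.
Qed.

Lemma hausdorff_dist_mix t A B C D e : 0 <= t <= 1 ->
  hausdorff_dist A C <= e -> hausdorff_dist B D <= e ->
  hausdorff_dist (mix t A B) (mix t C D) <= e.
Proof.
move=> t01 ACe BDe; apply: hausdorff_dist_le.
  by rewrite (le_trans _ ACe)// hdist_ge0.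
suff H A' B' C' D' d : e < d -> hausdorff_dist A' (cb_set C') <= e ->
    hausdorff_dist B' (cb_set D') <= e ->
    forall x, cb_set (mix t A' B') x ->
      exists2 y, cb_set (mix t C' D') y & `|x - y| < d.
  by move=> d ed; split; apply: H; rewrite // hausdorff_dist_sym.
(* The gap [d - e] is split in two: one half pays for the closure in [mix], the other for the infima
   in the two Hausdorff distances. *)
move=> ed AC BD x /mixP/(_ ((d - e) / 2))[]; first by rewrite divr_gt0// subr_gt0.
move=> a [b [Aa Bb xab]].
have emid : e < (e + d) / 2 by rewrite midf_lt.
have [c Cc ac] := hdist_lt (le_lt_trans AC emid) Aa.
have [d' Dd' bd] := hdist_lt (le_lt_trans BD emid) Bb.
exists (t *: c + (1 - t) *: d').
  by apply/subset_closure; exists (c, d').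
apply: (le_lt_trans (ler_distD (t *: a + (1 - t) *: b) _ _)).
by have := norm_conv_lt t01 ac bd => ?; lra.
Qed.

(** Passing from [s] to [t] moves [s *: a + (1 - s) *: b] by [(s - t) *: (a - b)], and [a - b] is
    bounded on [A] and [B]; adding 1 to the bound makes it positive. *)
Lemma hausdorff_dist_mixl A B :
  exists2 M, 0 < M &
    forall s t, hausdorff_dist (mix s A B) (mix t A B) <= `|s - t| * M.
Proof.
have [[M AM] [N BN]] := (cb_bounded A, cb_bounded B).
exists (`|M| + `|N| + 1) => [|s t]; first by rewrite ltr_wpDl// addr_ge0.
apply: hausdorff_dist_le; first by rewrite mulr_ge0// !addr_ge0.
suff H s' t' d : `|s' - t'| * (`|M| + `|N| + 1) < d ->
    forall x, cb_set (mix s' A B) x ->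
      exists2 y, cb_set (mix t' A B) y & `|x - y| < d.
  by move=> d std; split; apply: H; rewrite // distrC.
move=> std x /mixP.
case/(_ (d - `|s' - t'| * (`|M| + `|N| + 1))); first by rewrite subr_gt0.
move=> a [b [Aa Bb xab]]; exists (t' *: a + (1 - t') *: b).
  by apply/subset_closure; exists (a, b).
apply: (le_lt_trans (ler_distD (s' *: a + (1 - s') *: b) _ _)).
rewrite -ltrBrDr (lt_le_trans xab)// lerB//.
rewrite opprD addrACA -!scalerBl (_ : 1 - s' - (1 - t') = - (s' - t')); last by lra.
rewrite scaleNr -scalerBr normrZ ler_wpM2l// (le_trans (ler_normB _ _))//.
rewrite (@le_trans _ _ (`|M| + `|N|))// ?lerDl// lerD//.
  by rewrite (le_trans (AM _ Aa))// ler_norm.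
by rewrite (le_trans (BN _ Bb))// ler_norm.
Qed.

(** The combination of compact sets is a continuous image of their product, hence compact and
    closed, so the closure in [mix] adds nothing. *)
Lemma compact_mix t A B :
  compact (cb_set A) -> compact (cb_set B) -> compact (cb_set (mix t A B)).
Proof.
move=> cA cB; have cAB : compact (mix_set t A B).
  apply: continuous_compact; last exact: compact_setX.
  apply: continuous_subspaceT => p.
  by apply: cvgD; apply: cvgZ; first [exact: cvg_cst | exact: cvg_fst | exact: cvg_snd].
rewrite /mix /= -(closure_id _).1//.
by apply: compact_closed => //; exact: norm_hausdorff.
Qed.

End minkowski_combination.

(** * Closed convex hulls *)

Section closed_convex_hull.
Context {R : realType} {L : completeNormedModType R}.
Implicit Types (S T : set L) (A B : CB L).

(** In this form, a property passes from [S] to its hull as soon as the points having it form a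
    closed convex set. *)
Definition closed_convex_hull S : set L :=
  [set x | forall C, closed C -> convex_set C -> S `<=` C -> C x].

Lemma sub_closed_convex_hull S : S `<=` closed_convex_hull S.
Proof. by move=> x Sx C _ _; exact. Qed.

Lemma closed_closed_convex_hull S : closed (closed_convex_hull S).
Proof.
move=> x clx C clC cC SC; apply: (clC) => U /clx[y [Sy Uy]].
by exists y; split => //; apply: Sy.
Qed.

Lemma convex_closed_convex_hull S : convex_set (closed_convex_hull S).
Proof.
apply/convex_setP => x y k k01 Sx Sy C clC cC SC.
by apply: (convex_setP C).1 => //; [exact: Sx | exact: Sy].
Qed.

Lemma closed_convex_hull_CB S : S !=set0 -> bounded_set S ->
  exists A, cb_set A = closed_convex_hull S.
Proof.
move=> [x Sx] /bounded_set_normP[M SM].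
suff CBS : [/\ closed_convex_hull S !=set0, closed (closed_convex_hull S),
    bounded_set (closed_convex_hull S) & convex_set (closed_convex_hull S)].
  by exists (MkCB CBS).
split.
- by exists x; exact: sub_closed_convex_hull.
- exact: closed_closed_convex_hull.
- apply/bounded_set_normP; exists M => y Sy.
  apply: (Sy [set z | `|z| <= M]).
  + apply: (@preimage_closed _ _ (fun z : L => `|z|)) (@closed_le R M) => ? _.
    exact: norm_continuous.
  + apply/convex_setP => u v k /andP[k0 k1] /= uM vM.
    rewrite (le_trans (ler_normD _ _))// !normrZ !ger0_norm ?subr_ge0//.
    rewrite (_ : M = k * M + (1 - k) * M); last by rewrite -mulrDl subrKC mul1r.
    by rewrite lerD// ler_wpM2l// subr_ge0.
  + exact: SM.
- exact: convex_closed_convex_hull.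
Qed.

Lemma closed_convex_hull_id A : closed_convex_hull (cb_set A) = cb_set A.
Proof.
apply/seteqP; split; last exact: sub_closed_convex_hull.
by have [_ clA _ cA] := cb_setP A; move=> x; apply.
Qed.

(* The closed [e]-neighbourhood of a convex set is convex, so it contains the
   hull of any set that it contains. *)
Lemma closed_convex_hull_near S T e :
  (forall x d, S x -> e < d -> exists2 y, closed_convex_hull T y & `|x - y| < d) ->
  forall x d, closed_convex_hull S x -> e < d ->
    exists2 y, closed_convex_hull T y & `|x - y| < d.
Proof.
move=> ST x d Sx; move: d.
apply: (Sx [set x | forall d, e < d ->
  exists2 y, closed_convex_hull T y & `|x - y| < d]) => [y|| y Sy d]; last first.
- exact: ST.
- apply/convex_setP => u v k k01 uT vT d ed.
  have [[u' Tu' uu'] [v' Tv' vv']] := (uT _ ed, vT _ ed).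
  exists (k *: u' + (1 - k) *: v'); last exact: norm_conv_lt.
  exact: (convex_setP _).1 (@convex_closed_convex_hull T) _ _ _ _ _ _.
- move=> /closure_normP yS d ed.
  have [z zT yz] := yS ((d - e) / 2) (ltac:(by rewrite divr_gt0// subr_gt0)).
  have [w Tw zw] := zT ((e + d) / 2) (ltac:(by rewrite midf_lt)).
  exists w => //; apply: (le_lt_trans (ler_distD z _ _)); lra.
Qed.

End closed_convex_hull.

(** * Order properties of well-orders *)

Lemma well_order_total (T : eqType) (W : rel T) : well_order W ->
  forall a b, W a b \/ W b a.
Proof.
move=> wo a b; have [|m [[]]] := wo [pred x | (x == a) || (x == b)].
  by exists a; rewrite inE eqxx.
by rewrite !inE => /orP[]/eqP-> lb _; [left|right]; apply: lb; rewrite inE eqxx ?orbT.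
Qed.

(** Both [a] and [b] would be least in the pair they form, and least elements are unique. *)
Lemma well_order_antisym (T : eqType) (W : rel T) : well_order W ->
  forall a b, W a b -> W b a -> a = b.
Proof.
move=> wo a b Wab Wba; have W_refl x : W x x by case: (well_order_total wo x x).
have [|m [_ muniq]] := wo [pred x | (x == a) || (x == b)].
  by exists a; rewrite inE eqxx.
by rewrite -(muniq a) ?(muniq b)//; split; rewrite ?inE ?eqxx ?orbT// => x;
  rewrite inE => /orP[]/eqP->.
Qed.

(** * Stone's layers in the complement of a closed set *)

Section metric_layers.
Context {R : realType} {Z : topologicalType} (d : Z -> Z -> R).
Hypothesis d_eq0 : forall x y, d x y = 0 <-> x = y.
Hypothesis d_sym : forall x y, d x y = d y x.
Hypothesis d_triangle : forall x y z, d x z <= d x y + d y z.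
Hypothesis nbhs_dP : forall x (U : set Z),
  nbhs x U <-> exists2 e, 0 < e & [set y | d x y < e] `<=` U.
Implicit Types (S T A : set Z) (x y z : Z) (e r : R).

Lemma d_ge0 x y : 0 <= d x y.
Proof.
by have := d_triangle x y x; rewrite (proj2 (d_eq0 x x))// (d_sym y) => h; lra.
Qed.

Lemma near_d_lt x e : 0 < e -> \forall y \near x, d x y < e.
Proof. by move=> e0; apply/nbhs_dP; exists e. Qed.

Definition dset x S : R := inf [set d x y | y in S].

Lemma dset_le x S y : S y -> dset x S <= d x y.
Proof.
by move=> Sy; apply: ge_inf; [exists 0 => _ [? _ <-]; exact: d_ge0|exists y].
Qed.

Lemma dset_lt x S e : S !=set0 -> dset x S < e -> exists2 y, S y & d x y < e.
Proof.
move=> [y Sy] xS; have [|_ [z Sz <-] ?] := inf_lt _ xS; last by exists z.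
by exists (d x y), y.
Qed.

Lemma dset_ge0 x S : S !=set0 -> 0 <= dset x S.
Proof.
by move=> [y Sy]; apply: lb_le_inf => [|_ [? _ <-]]; [exists (d x y), y|exact: d_ge0].
Qed.

Lemma dset_lip x y S : S !=set0 -> dset x S <= d x y + dset y S.
Proof.
move=> S0; apply/ler_addgt0Pr => e e0.
have [z Sz yz] : exists2 z, S z & d y z < dset y S + e.
  by apply: dset_lt => //; rewrite ltrDl.
by have := d_triangle x y z; have := dset_le x Sz => ? ?; lra.
Qed.

Lemma continuous_dset S : S !=set0 -> continuous (dset^~ S).
Proof.
move=> S0 x; apply/cvgrPdist_lt => e e0; near=> y.
have xy : d x y < e by near: y; exact: near_d_lt.
have := dset_lip x y S0; have := dset_lip y x S0; rewrite (d_sym y) => h1 h2.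
by rewrite ltr_norml; apply/andP; split; lra.
Unshelve. all: by end_near. Qed.

Lemma bump_function T r : 0 < r -> exists psi : Z -> R,
  [/\ continuous psi, forall x, 0 <= psi x <= 1,
      forall x y, T y -> d x y < r / 8 -> psi x = 1 &
      forall x, 0 < psi x -> exists2 y, T y & d x y < r / 4].
Proof.
(* An empty infimum is 0, so for empty [T] the general formula would give 1 everywhere; the zero
   function is taken instead. *)
move=> r0; have [->|/set0P T0] := eqVneq T set0.
  exists (cst 0); split=> //; first by move=> x; exact: cvg_cst.
    by move=> x; rewrite lexx ler01.
  by move=> x; rewrite ltxx.
(* As a function of the distance to [T], this is 1 up to [r / 8], then decreases linearly to 0 at
   [r / 4]. *)
exists (fun x => Num.min 1 (Num.max 0 (2 - 8 / r * dset x T))); split.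
- move=> x; apply: (@continuous_min _ _ (cst 1) (fun x => Num.max 0 _)).
    exact: cvg_cst.
  apply: (@continuous_max _ _ (cst 0) (fun x => 2 - _)); first exact: cvg_cst.
  apply: cvgB; first exact: cvg_cst.
  by apply: cvgM; [exact: cvg_cst|exact: continuous_dset].
- by move=> x; rewrite le_min ler01 le_max lexx /= ge_min lexx.
- move=> x y Ty xy; apply/min_idPl; rewrite le_max; apply/orP; right.
  have : 8 / r * dset x T < 1.
    rewrite -mulrA mulrC -ltr_pdivlMr// mul1r ltr_pdivrMl//.
    by apply: le_lt_trans xy; exact: dset_le.
  by move=> h; lra.
- move=> x; rewrite lt_min ltr01 /= lt_max ltxx /= subr_gt0 => xT.
  apply: dset_lt => //; rewrite -(ltr_pM2l (_ : 0 < 8 / r)) ?divr_gt0//.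
  rewrite (_ : 8 / r * (r / 4) = 2); first by lra.
  by field; rewrite gt_eqF.
Qed.

(* For a well-order on [A] and [U a := {x | d x a < 2 * dset x A}], the n-th
   layer attached to [a] consists of the points [x] outside the [U b] for [b]
   before [a] with [ball x r_n] included in [U a]. As in Stone's theorem, the
   layers attached to different points of [A] are [r_n] apart. *)
Lemma discrete_layers A : closed A -> A !=set0 ->
  exists (psi : nat -> Z -> R) (alpha : nat -> Z -> Z),
  [/\ forall n, continuous (psi n), forall n x, 0 <= psi n x <= 1,
      forall n x a, A a -> 0 < psi n x -> A (alpha n x) /\ d a (alpha n x) < 3 * d a x,
      forall n x, exists2 b, A b & \forall y \near x, 0 < psi n y -> alpha n y = b &
      forall x, ~ A x -> exists n, \forall y \near x, psi n y = 1].
Proof.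
move=> clA [a0 Aa0]; have A0 : A !=set0 by exists a0.
have [W wo] := well_ordering_principle Z.
pose U a := [set x | d x a < 2 * dset x A].
pose r n : R := n.+1%:R^-1.
have r0 n : 0 < r n by rewrite invr_gt0.
pose T n a := [set x | [/\ A a, [set y | d x y < r n] `<=` U a &
  forall b, A b -> W b a -> b != a -> ~ U b x]].
(* If [a] comes before [b], then [y] lies in the [r n]-ball about [x], hence in [U a], which
   membership of [y] in [T n b] forbids; the other case is symmetric. *)
have sepT n a b x y : T n a x -> T n b y -> d x y < r n -> a = b.
  move=> [Aa xU xb] [Ab yU yb] xy; apply/eqP/negPn/negP => ab.
  case: (well_order_total wo a b) => [Wab|Wba].
    by apply: (yb _ Aa Wab ab); exact: xU.
  by apply: (xb _ Ab Wba); [rewrite eq_sym|apply: yU => /=; rewrite d_sym].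
have /choice[psi psiP] n := bump_function (\bigcup_a T n a) (r0 n).
have /choice[alpha alphaP] (p : nat * Z) : exists a, 0 < psi p.1 p.2 ->
    exists2 y, T p.1 a y & d p.2 y < r p.1 / 4.
  have [_ _ _ /(_ p.2) near_T] := psiP p.1.
  have [/near_T[y [a _ Ty] py]|np] := pselect (0 < psi p.1 p.2).
    by exists a => _; exists y.
  by exists a0 => /np.
have alphaU n x : 0 < psi n x -> A (alpha (n, x)) /\ U (alpha (n, x)) x.
  move=> /(alphaP (n, x))[y [Aa yU _]] /= xy; split=> //; apply: yU => /=.
  by rewrite d_sym (lt_trans xy)// ltr_pdivrMr// ltr_pMr// ltr1n.
exists psi, (fun n x => alpha (n, x)); split.
- by move=> n; case: (psiP n).
- by move=> n; case: (psiP n).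
- move=> n x a Aa /alphaU[Aal Ux]; split=> //.
  (* The attached point is within [2 * dset x A <= 2 * d a x] of [x], whence the factor 3. *)
  have := dset_le x Aa; rewrite /U/= in Ux.
  by have := d_triangle a x (alpha (n, x)); rewrite (d_sym x a) => ? ?; lra.
- move=> n x.
  (* Two points of the [r n / 8]-ball about [x] where [psi n] is positive have layer points less
     than [3 * r n / 4] apart, so [sepT] gives both the same attached point. *)
  have [[z [xz z0]]|nz] := pselect (exists z, d x z < r n / 8 /\ 0 < psi n z).
    exists (alpha (n, z)); first by case: (alphaU _ _ z0).
    apply: filterS (near_d_lt x (_ : 0 < r n / 8)); last by rewrite divr_gt0.
    move=> y xy y0; have [u Tu yu] := alphaP (n, y) y0.
    have [v Tv zv] := alphaP (n, z) z0; apply: sepT Tu Tv _ => /=.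
    move: yu zv => /=; have := d_triangle u y v; have := d_triangle y x v.
    have := d_triangle x z v; rewrite (d_sym u y) (d_sym y x) => ? ? ? ? ?.
    by have := r0 n => ?; lra.
  exists a0 => //.
  apply: filterS (near_d_lt x (_ : 0 < r n / 8)); last by rewrite divr_gt0.
  by move=> y xy y0; case: nz; exists y.
- move=> x nAx.
  have dx0 : 0 < dset x A.
    rewrite lt_def dset_ge0// andbT; apply/eqP => dx0; apply: nAx.
    apply: clA => V /nbhs_dP[e e0 eV].
    have [|y Ay xy] := @dset_lt x A e A0; first by rewrite dx0.
    by exists y; split => //; exact: eV.
  (* Take the first [a] with [x] in [U a]: minimality keeps [x] outside the earlier sets [U b]. *)
  have [|a [[/asboolP[Aa Ua] amin] _]] :=
      wo [pred a | `[< A a /\ U a x >]].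
    have [|b Ab xb] := @dset_lt x A (2 * dset x A) A0; last first.
      by exists b; apply/asboolP.
    by rewrite ltr_pMl// ltr1n.
  (* Moving [x] by less than [e] raises [d x a] by less than [e] and lowers [2 * dset x A] by less
     than [2 * e], so the [e]-ball about [x] stays in [U a]. *)
  pose e := (2 * dset x A - d x a) / 3.
  have e0 : 0 < e by rewrite divr_gt0// subr_gt0.
  have [n rn] : exists n, r n < e.
    have [n _ /(_ n (leqnn n)) rn] := near_infty_natSinv_lt (PosNum e0).
    by exists n.
  exists n; apply: filterS (near_d_lt x (_ : 0 < r n / 8)); last by rewrite divr_gt0.
  move=> y xy; have [_ _ /(_ y x) psi1 _] := psiP n; apply: psi1.
    exists a => //; split=> // [z /= xz|b Ab Wba ba Ub].
      have := d_triangle z x a; have := dset_lip x z A0; rewrite (d_sym z x) /e in rn *.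
      by rewrite /U/= => ? ?; lra.
    have Wab : W a b by apply: amin; apply/asboolP.
    by move/eqP: ba; apply; exact: (well_order_antisym wo Wba Wab).
  by rewrite d_sym.
Qed.

End metric_layers.

(** * Iterated combinations and the Dugundji extension *)

Section tower.
Context {R : realType} {L : completeNormedModType R}.
Implicit Types (p : nat -> R) (g : nat -> CB L) (B C : CB L).

(* [p_k g_k + (1 - p_k) (p_(k+1) g_(k+1) + (1 - p_(k+1)) (...))] with [m]
   levels, ending with [B]; the levels after the first [p_n = 1] are ignored. *)
Fixpoint tower p g B m k : CB L :=
  if m is m'.+1 then mix (p k) (g k) (tower p g B m' k.+1) else B.

Lemma towerS p g B m k :
  tower p g B m.+1 k = mix (p k) (g k) (tower p g B m k.+1).
Proof. by []. Qed.

(** At level [k + i] the weight 1 makes [mix] discard everything below. *)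
Lemma tower_stable p g B i j k : p (k + i)%N = 1 ->
  tower p g B (i.+1 + j) k = tower p g B i.+1 k.
Proof.
elim: i k => [|i IH] k pi; first by rewrite addn0 in pi; rewrite /= pi !mix1.
by rewrite addSn towerS [RHS]towerS IH// addSnnS.
Qed.

Lemma tower_pred p g B (Q : set (CB L)) m k :
  (forall t C D, Q C -> Q D -> Q (mix t C D)) ->
  (forall n, Q (g n)) -> Q B -> Q (tower p g B m k).
Proof. by move=> Qmix Qg QB; elim: m k => //= m IH k; exact: Qmix. Qed.

(** By convexity [C] is a combination of itself with itself, so it can be compared with the tower
    level by level; levels of weight 0 drop out, and the final weight 1 removes [B]. *)
Lemma tower_near p g B C e i k : 0 <= e -> (forall n, 0 <= p n <= 1) ->
  (forall n, 0 < p n -> hausdorff_dist C (g n) <= e) -> p (k + i)%N = 1 ->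
  hausdorff_dist C (tower p g B i.+1 k) <= e.
Proof.
move=> e0 p01 gC; elim: i k => [|i IH] k pi; rewrite towerS.
  by rewrite addn0 in pi; rewrite pi mix1 gC// pi.
have [pk0|pk0] := eqVneq (p k) 0.
  by rewrite pk0 mix0; apply: IH; rewrite addSnnS.
rewrite -{1}(mixxx C (p01 k)).
apply: hausdorff_dist_mix => //; last by apply: IH; rewrite addSnnS.
by apply: gC; rewrite lt_def pk0; case/andP: (p01 k).
Qed.

Lemma cvg_mix (T : Type) (F : set_system T) {FF : Filter F}
    (p : T -> R) (h : T -> CB L) t C D :
  (forall x, 0 <= p x <= 1) -> p @ F --> t -> h @ F --> D ->
  mix (p x) C (h x) @[x --> F] --> mix t C D.
Proof.
move=> p01 pt hD; apply/cvg_CBP => e e0.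
have [M M0 MP] := hausdorff_dist_mixl C D.
have pM : 0 < e / 2 / M by rewrite !divr_gt0.
move/cvgrPdist_lt : pt => /(_ _ pM) pt.
move/cvg_CBP : hD => /(_ (e / 2)) hD.
near=> x.
apply: (le_lt_trans (hausdorff_dist_triangle (mix (p x) C D) _ _)).
rewrite (splitr e); apply: ltr_leD.
  by rewrite (le_lt_trans (MP _ _))// -ltr_pdivlMr//; near: x.
apply: hausdorff_dist_mix => //; first by rewrite hausdorff_distxx divr_ge0 ?ltW.
by apply/ltW; near: x; apply: hD; rewrite divr_gt0.
Unshelve. all: by end_near. Qed.

(** Near each point [g k] can be replaced by a constant set: it equals that set where [psi k] is
    positive, and elsewhere weight 0 discards it. *)
Lemma continuous_tower (Z : topologicalType) (psi : nat -> Z -> R)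
    (g : nat -> Z -> CB L) B m k :
  (forall n, continuous (psi n)) -> (forall n x, 0 <= psi n x <= 1) ->
  (forall n (x : Z), exists C, \forall y \near x, 0 < psi n y -> g n y = C) ->
  continuous (fun x => tower (psi^~ x) (g^~ x) B m k).
Proof.
move=> cpsi psi01 gC; elim: m k => [|m IH] k x /=; first exact: cvg_cst.
have [C CP] := gC k x.
have {}CP : \forall y \near x,
    mix (psi k y) C (tower (psi^~ y) (g^~ y) B m k.+1) =
    mix (psi k y) (g k y) (tower (psi^~ y) (g^~ y) B m k.+1).
  apply: filterS CP => y CP.
  have [->|py] := eqVneq (psi k y) 0; first by rewrite !mix0.
  by rewrite CP// lt_def py; case/andP: (psi01 k y).
apply: cvg_trans (near_eq_cvg CP) _.
have := cvg_mix (C := C) (psi01 k) (cpsi k x) (IH k.+1 x).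
by rewrite (nbhs_singleton CP); apply.
Qed.

Theorem dugundji_CB (Z : topologicalType) (A : set Z) (f : Z -> CB L)
    (Q : set (CB L)) :
  metrizable R Z -> closed A -> A !=set0 -> {within A, continuous f} ->
  (forall t C D, Q C -> Q D -> Q (mix t C D)) -> (forall z, Q (f z)) ->
  exists F : Z -> CB L,
    [/\ continuous F, forall z, Q (F z) & forall a, A a -> F a = f a].
Proof.
move=> [d [d_eq0 d_sym d_tri nbhs_dP]] clA A0 fc Qmix Qf.
have [psi [alpha [psic psi01 alphaA alpha_loc psi1]]] :=
  discrete_layers d_eq0 d_sym d_tri nbhs_dP clA A0.
have [a0 Aa0] := A0.
pose P m z := tower (psi^~ z) (fun n => f (alpha n z)) (f a0) m 0.
have Pc m : continuous (P m).
  apply: continuous_tower => // n z; have [b _ bP] := alpha_loc n z.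
  by exists (f b); apply: filterS bP => y yb /yb ->.
have /choice[N NP] z : exists n, ~ A z -> psi n z = 1.
  have [Az|/psi1[n /nbhs_singleton nz]] := pselect (A z); last by exists n.
  by exists 0%N.
(* The choice [N] has no regularity in [z], but any level of weight 1 gives the same value; near a
   point off [A] one fixed [n] therefore serves, and continuity of [P n.+1] applies. *)
have PN n z : ~ A z -> psi n z = 1 -> P (N z).+1 z = P n.+1 z.
  move=> Az nz; have stable m : psi m z = 1 -> P (m.+1 + maxn n (N z)) z = P m.+1 z.
    by move=> mz; rewrite /P tower_stable.
  have e m m' : psi m z = 1 -> psi m' z = 1 -> (m <= m')%N ->
      P m'.+1 z = P m.+1 z.
    move=> mz m'z mm'; rewrite -(subnKC mm') -addSn /P tower_stable//.
  by case: (leqP n (N z)) => [|/ltnW] nN; [|symmetry]; apply: e => //; exact: NP.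
exists (fun z => if pselect (A z) then f z else P (N z).+1 z).
have FN z : ~ A z -> (if pselect (A z) then f z else P (N z).+1 z) = P (N z).+1 z.
  by case: pselect.
have FA z : A z -> (if pselect (A z) then f z else P (N z).+1 z) = f z.
  by case: pselect.
split=> // [z|z]; last first.
  have [Az|Az] := pselect (A z); first by rewrite FA.
  by rewrite FN//; apply: tower_pred.
have [Az|Az] := pselect (A z); last first.
  have [n nz] := psi1 _ Az.
  have nA : \forall y \near z, ~ A y by move: clA; rewrite -openC openE; exact.
  have FP : \forall y \near z,
      P n.+1 y = (if pselect (A y) then f y else P (N y).+1 y).
    by near=> y; rewrite FN ?(@PN n)//; near: y.
  apply: cvg_trans (near_eq_cvg FP) _.
  by have := Pc n.+1 z; rewrite /continuous_at (nbhs_singleton FP).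
rewrite /continuous_at (FA z)//.
apply/cvg_CBP => e e0; have e2 : 0 < e / 2 by rewrite divr_gt0.
have /cvg_CBP/(_ (e / 2) e2) : f @ within A (nbhs z) --> f z.
  exact: (proj1 (subspace_continuousP A f) fc z Az).
rewrite near_withinE => /nbhs_dP[r r0 rf].
(* An attached point is less than [3 * d z y] from [z], so [r / 3] keeps it where [f] is
   controlled. *)
have r3 : 0 < r / 3 by rewrite divr_gt0.
apply: filterS (near_d_lt nbhs_dP z r3) => y zy.
apply: (@le_lt_trans _ _ (e / 2)); last by rewrite ltr_pdivrMr// ltr_pMr// ltr1n.
have [Ay|Ay] := pselect (A y).
  by rewrite FA//; apply/ltW/rf => //=; lra.
rewrite FN//; apply: tower_near => [|//|n yn|]; first exact: ltW.
  have [An zn] := alphaA n y z Az yn.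
  by apply/ltW/rf => //=; lra.
by rewrite add0n; exact: NP.
Unshelve. all: by end_near. Qed.

End tower.

(** * Hulls of families of sets indexed by a compact space *)

Section compact_hull.
Context {R : realType} {L : completeNormedModType R} {G : topologicalType}.
Hypothesis compactG : compact [set: G].
Implicit Types (Psi : G -> CB L) (K S : set L).

(** A bound for [Psi g], increased by 1, serves for all nearby indices; compactness, with the bound
    tending to infinity as parameter, makes it global. *)
Lemma bounded_family Psi : continuous Psi ->
  exists M, forall g x, cb_set (Psi g) x -> `|x| <= M.
Proof.
move=> cPsi.
have : \forall M \near +oo%R,
    [set: G] `<=` [set g | forall x, cb_set (Psi g) x -> `|x| <= M].
  apply: (proj1 (compact_near_coveringP _) compactG) => g _.
  have [M gM] := cb_bounded (Psi g).
  exists ([set h | hausdorff_dist (Psi g) (Psi h) < 1], [set N | M + 1 <= N]).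
    split => /=; last exact/nbhs_pinfty_ge/num_real.
    exact: (cPsi g _ (near_CB_lt (Psi g) ltr01)).
  move=> [h N] /= [gh MN] x hx.
  have [|y /gM yM xy] := @hdist_lt _ _ (Psi h) (Psi g) 1 _ x hx.
    by rewrite hausdorff_dist_sym.
  rewrite (le_trans _ MN)// -(subrK y x) (le_trans (ler_normD _ _))// addrC.
  by rewrite lerD// ltW.
by move=> /(@filter_ex _ _ _)[M MP]; exists M => g; exact: MP.
Qed.

Lemma closed_convex_hull_family Psi : G -> continuous Psi ->
  exists C : CB L, cb_set C = closed_convex_hull (\bigcup_g cb_set (Psi g)).
Proof.
move=> g /bounded_family[M PsiM]; apply: closed_convex_hull_CB.
  by have [x] := CB_nonempty (Psi g); exists x, g.
by apply/bounded_set_normP; exists M => x [h _]; exact: PsiM.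
Qed.

(** Containing 0 puts [K1] and [K2] inside their Minkowski sum, so these sets are directed by
    inclusion. *)
Let pointed_compact_convex K := [/\ compact K, convex_set K & K 0].

Let pointed_compact_convexD K1 K2 : pointed_compact_convex K1 ->
  pointed_compact_convex K2 ->
  exists2 K, pointed_compact_convex K & K1 `<=` K /\ K2 `<=` K.
Proof.
move=> [c1 /convex_setP v1 K1_0] [c2 /convex_setP v2 K2_0].
exists [set p.1 + p.2 | p in K1 `*` K2]; last first.
  split=> x Kx; first by exists (x, 0) => //=; rewrite addr0.
  by exists (0, x) => //=; rewrite add0r.
split; last by exists (0, 0) => //=; rewrite addr0.
- apply: continuous_compact; last exact: compact_setX.
  by apply: continuous_subspaceT => p; apply: cvgD; [exact: cvg_fst|exact: cvg_snd].
- apply/convex_setP => _ _ k k01 [[x y] [/= ? ?] <-] [[x' y'] [/= ? ?] <-].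
  exists (k *: x + (1 - k) *: x', k *: y + (1 - k) *: y') => /=.
    by split; [exact: v1 | exact: v2].
  by rewrite !scalerDr addrACA.
Qed.

Let pointed_compact_convex_hull K : compact K -> convex_set K -> K !=set0 ->
  exists2 K', pointed_compact_convex K' & K `<=` K'.
Proof.
move=> cK /convex_setP vK [k0 Kk0].
(* Translating [K] by [- k0] brings 0 in; adding the segment from 0 to [k0] recovers [K] at
   parameter 1. *)
exists [set (p.1 - k0) + p.2 *: k0 | p in K `*` `[0, 1]]; last first.
  move=> x Kx; exists (x, 1) => /=; last by rewrite scale1r subrK.
  by split=> //; rewrite in_itv/= ler01 lexx.
split.
- apply: continuous_compact; last by apply: compact_setX => //; exact: segment_compact.
  apply: continuous_subspaceT => p.
  apply: cvgD; first by apply: cvgB; [exact: cvg_fst|exact: cvg_cst].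
  by apply: cvgZ; [exact: cvg_snd|exact: cvg_cst].
- apply/convex_setP => _ _ k k01 [[x s] [/= Kx +] <-] [[x' s'] [/= Kx' +] <-].
  rewrite !in_itv/= => s01 s'01.
  exists (k *: x + (1 - k) *: x', k * s + (1 - k) * s') => /=.
    split; first exact: vK.
    rewrite in_itv/=; move/andP: k01 s01 s'01 => [k0' k1'] /andP[? ?] /andP[? ?].
    by apply/andP; split; nra.
  rewrite !scalerDr !scalerN (scalerDl k0) !scalerA [RHS]addrACA; congr (_ + _).
  by rewrite [RHS]addrACA -opprD -scalerDl subrKC scale1r.
- by exists (k0, 0) => /=; rewrite ?subrr ?scale0r ?addr0// in_itv/= lexx ler01.
Qed.

(** One compact convex [K] lies within [e / 2] of every [Psi g]; being its own closed hull, it also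
    approximates the hull of the union, and [compact_approx] applies. *)
Lemma compact_closed_convex_hull_family Psi : continuous Psi ->
  (forall g, compact (cb_set (Psi g))) ->
  compact (closed_convex_hull (\bigcup_g cb_set (Psi g))).
Proof.
move=> cPsi Psi_compact.
apply: compact_approx => [|e e0]; first exact: closed_closed_convex_hull.
have e2 : 0 < e / 2 by rewrite divr_gt0.
(* The filter of sufficiently large [K] serves as parameter in the near-covering form of
   compactness, replacing a finite subcover and the sum of its sets. *)
pose F := filter_from [set K | pointed_compact_convex K]
  (fun K0 => [set K | pointed_compact_convex K /\ K0 `<=` K]).
have FF : Filter F.
  apply: filter_from_filter.
    exists [set 0]; split=> //; first exact: compact_set1.
    by apply/convex_setP => _ _ k _ -> ->; rewrite !scaler0 addr0.
  move=> K1 K2 gK1 gK2; have [K gK [K1K K2K]] := pointed_compact_convexD gK1 gK2.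
  by exists K => // K' [gK' KK']; split; split=> //; exact: subset_trans KK'.
have : \forall K \near F, [set: G] `<=` [set g | forall x, cb_set (Psi g) x ->
    exists2 y, K y & `|x - y| < e / 2].
  apply: (proj1 (compact_near_coveringP _) compactG) => g _.
  have [_ _ _ vg] := cb_setP (Psi g).
  have [K0 gK0 gK0P] := pointed_compact_convex_hull (Psi_compact g) vg (CB_nonempty _).
  exists ([set h | hausdorff_dist (Psi g) (Psi h) < e / 2],
          [set K | pointed_compact_convex K /\ K0 `<=` K]).
    split => /=; first exact: (cPsi g _ (near_CB_lt (Psi g) e2)).
    by exists K0.
  move=> [h K] /= [gh [_ K0K]] x hx.
  have [|y gy xy] := @hdist_lt _ _ (Psi h) (Psi g) (e / 2) _ x hx.
    by rewrite hausdorff_dist_sym.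
  by exists y => //; exact/K0K/gK0P.
move=> [K gK /(_ K)]/= => /(_ (conj gK (@subset_refl _ K))) KP.
have [cK vK K0] := gK; exists K => // x Sx.
have hullK y : closed_convex_hull K y -> K y.
  by apply => //; apply: compact_closed => //; exact: norm_hausdorff.
have [||y /hullK Ky xy] := @closed_convex_hull_near _ _ _ K (e / 2) _ x e Sx.
- move=> y d [g _ gy] ed; have [z Kz yz] := KP g I y gy.
  by exists z; [exact: sub_closed_convex_hull|exact: lt_trans ed].
- by rewrite ltr_pdivrMr// ltr_pMr// ltr1n.
- by exists y.
Qed.

End compact_hull.

(** * The action on closed bounded convex sets and equivariant hulls *)

Section averaging.
Context {G : topologicalGroupType} {R : realType} {L : completeNormedModType R}.
Hypothesis compactG : compact [set: G].
Variable a : banachGaction G L.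
Implicit Types (A B C : CB L) (g h : G).

Lemma bactB g x y : a g (x - y) = a g x - a g y.
Proof. by have := bact_linear a g 1 (-1) x y; rewrite !scale1r !scaleN1r. Qed.

Lemma CB_act_is_action : is_action (CB_act a).
Proof.
have [[a1 aM] _] := bact_Gspace a; split=> [A|g h A]; apply: CB_eq => /=.
  by rewrite -[RHS]image_id; apply: eq_imagel => x _; rewrite a1.
by rewrite image_comp; apply: eq_imagel => x _; rewrite /= aM.
Qed.

Lemma hausdorff_dist_act g A B :
  hausdorff_dist (CB_act a g A) (CB_act a g B) <= hausdorff_dist A B.
Proof.
apply: hausdorff_dist_le; first exact: hdist_ge0.
suff H A' B' e : hausdorff_dist A' (cb_set B') < e ->
    forall x, cb_set (CB_act a g A') x ->
      exists2 y, cb_set (CB_act a g B') y & `|x - y| < e.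
  by move=> e ABe; split; apply: H; rewrite // hausdorff_dist_sym.
move=> ABe _ [x Ax <-]; have [y By xy] := hdist_lt ABe Ax.
by exists (a g y); [exists y | rewrite -bactB bact_norm].
Qed.

(** Joint continuity of the action on [L] and compactness of [A] make [a g x] close to [a g0 x]
    uniformly for [x] in [A]. *)
Lemma compact_CB_act_continuous A :
  compact (cb_set A) -> continuous (fun g => CB_act a g A).
Proof.
move=> cA g0; apply/cvg_CBP => e e0; have e2 : 0 < e / 2 by rewrite divr_gt0.
have [_ ca] := bact_Gspace a.
have : \forall g \near g0, cb_set A `<=` [set x | `|a g0 x - a g x| < e / 2].
  apply: (proj1 (compact_near_coveringP _) cA) => x Ax.
  have e4 : 0 < e / 2 / 2 by rewrite divr_gt0.
  have swapc : (fun p : L * G => a p.2 p.1) @ (x, g0) --> a g0 x.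
    apply: (cvg_comp (fun p : L * G => (p.2, p.1)) _ _ (ca (g0, x))).
    by apply: cvg_pair; [exact: cvg_snd | exact: cvg_fst].
  have {}swapc : \forall p \near (x, g0), `|a g0 x - a p.2 p.1| < e / 2 / 2.
    by move/cvgrPdist_lt : swapc; apply.
  have xg0 : \forall p \near (x, g0), `|x - p.1| < e / 2 / 2.
    have : (fun p : L * G => p.1) @ (x, g0) --> x by exact: cvg_fst.
    by move/cvgrPdist_lt; apply.
  apply: filterS2 swapc xg0 => -[y g] /= yg xy.
  apply: (le_lt_trans (ler_distD (a g0 x) _ _)).
  by rewrite (splitr (e / 2)) ltrD// -bactB bact_norm distrC.
apply: filterS => g gP; apply: (@le_lt_trans _ _ (e / 2)).
  apply: hausdorff_dist_le => [|d ed]; first exact: ltW.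
  split=> _ [x Ax <-]; [exists (a g x)|exists (a g0 x)]; try by exists x.
    exact: lt_trans (gP _ Ax) ed.
  by rewrite distrC; exact: lt_trans (gP _ Ax) ed.
by rewrite ltr_pdivrMr// ltr_pMr// ltr1n.
Qed.

(** Every group element acts without increasing Hausdorff distances, so joint convergence reduces to
    continuity of the orbit map of the limit [A] at [g]. *)
Lemma CB_act_cvg (T : Type) (F : set_system T) {FF : Filter F}
    (u : T -> G) (v : T -> CB L) g A :
  {for g, continuous (fun h => CB_act a h A)} ->
  u @ F --> g -> v @ F --> A -> CB_act a (u x) (v x) @[x --> F] --> CB_act a g A.
Proof.
move=> cA ug vA; apply/cvg_CBP => e e0.
have e2 : 0 < e / 2 by rewrite divr_gt0.
have /cvg_CBP/(_ _ e2) := cvg_comp _ _ ug cA.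
move/cvg_CBP : vA => /(_ _ e2).
apply: filterS2 => x vx ux.
apply: (le_lt_trans (hausdorff_dist_triangle (CB_act a (u x) A) _ _)).
by rewrite (splitr e) ltrD// (le_lt_trans (hausdorff_dist_act _ _ _)).
Qed.

(* The hull of the sets [g^-1 F (g z)] replaces the Haar average of the map
   [g |-> g^-1 F (g z)]: it depends equivariantly on [z], and it is the value
   at [z] itself when that map is constant. *)
Lemma equivariant_hull (Z : topologicalType) (aZ : G -> Z -> Z) (F : Z -> CB L)
    (Q : set (CB L)) :
  Gspace aZ -> continuous F -> (forall z, Q (F z)) ->
  (forall A, Q A -> continuous (fun g => CB_act a g A)) ->
  (forall g A, Q A -> Q (CB_act a g A)) ->
  (forall (Psi : G -> CB L) C, continuous Psi -> (forall g, Q (Psi g)) ->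
    cb_set C = closed_convex_hull (\bigcup_g cb_set (Psi g)) -> Q C) ->
  exists H : Z -> CB L,
    [/\ continuous H, equivariant aZ (CB_act a) H, forall z, Q (H z) &
        forall z, (forall g, F (aZ g z) = CB_act a g (F z)) -> H z = F z].
Proof.
move=> [[aZ1 aZM] caZ] cF QF Qc Qact Qhull.
have [act1 actM] := CB_act_is_action.
pose Phi z g := CB_act a g^-1%g (F (aZ g z)).
have cPhi z g : (fun p : G * Z => Phi p.2 p.1) @ (g, z) --> Phi z g.
  apply: CB_act_cvg; first exact: (Qc _ (QF _)).
    by apply: cvg_comp; [exact: cvg_fst | exact: invg_continuous].
  by apply: cvg_comp; [exact: (caZ (g, z)) | exact: cF].
have cPhiz z : continuous (Phi z).
  move=> g; apply: (continuous_comp (f := fun g : G => (g, z))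
    (g := fun p : G * Z => Phi p.2 p.1)); last exact: cPhi.
  by apply: cvg_pair; [exact: cvg_id | exact: cvg_cst].
have /choice[H HE] z := closed_convex_hull_family compactG 1%g (cPhiz z).
exists H; split.
- move=> z; apply/cvg_CBP => e e0.
  have e2 : 0 < e / 2 by rewrite divr_gt0.
  (* Compactness of [G] makes the continuity of [Phi] in [z] uniform in [g]; passing through
     [Phi z g] compares both families at the same index [h]. *)
  have : \forall z' \near z,
      [set: G] `<=` [set g | hausdorff_dist (Phi z g) (Phi z' g) < e / 2].
    apply: (proj1 (compact_near_coveringP _) compactG) => g _.
    have e4 : 0 < e / 2 / 2 by rewrite divr_gt0.
    have n1 : \forall p \near (g, z),
        hausdorff_dist (Phi z g) (Phi p.2 p.1) < e / 2 / 2.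
      by move/cvg_CBP : (cPhi z g) => /(_ _ e4).
    have n2 : \forall p \near (g, z),
        hausdorff_dist (Phi z g) (Phi z p.1) < e / 2 / 2.
      have : (fun p : G * Z => Phi z p.1) @ (g, z) --> Phi z g.
        by apply: cvg_comp; [exact: cvg_fst | exact: cPhiz].
      by move/cvg_CBP => /(_ _ e4).
    apply: filterS2 n1 n2 => -[h z'] zz' zh.
    apply: (le_lt_trans (hausdorff_dist_triangle (Phi z g) (Phi z h) (Phi z' h))).
    by rewrite (splitr (e / 2)) ltrD// hausdorff_dist_sym.
  apply: filterS => z' zz'; apply: (@le_lt_trans _ _ (e / 2)); last first.
    by rewrite ltr_pdivrMr// ltr_pMr// ltr1n.
  have near_hull y y' : (forall g, hausdorff_dist (Phi y g) (Phi y' g) < e / 2) ->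
      forall d, e / 2 < d -> forall x, cb_set (H y) x ->
      exists2 x', cb_set (H y') x' & `|x - x'| < d.
    move=> yy' d ed x; rewrite !HE => Hx; apply: closed_convex_hull_near Hx ed.
    move=> {}x {}d [g _ gx] ed; have [x' gx' xx'] := hdist_lt (yy' g) gx.
    exists x'; last exact: lt_trans ed.
    by apply: sub_closed_convex_hull; exists g.
  apply: hausdorff_dist_le => [|d ed]; first exact: ltW.
  split; apply: near_hull ed => g; first exact: zz'.
  by rewrite hausdorff_dist_sym; exact: zz'.
(* The right side is closed and convex, so it suffices to place each [Phi (aZ h z) g] in it;
   reindexing by [g * h] does this. *)
- have sub h z : cb_set (H (aZ h z)) `<=` cb_set (CB_act a h (H z)).
    rewrite HE => x; have [_ clC _ vC] := cb_setP (CB_act a h (H z)).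
    apply => // {x} x [g _].
    have -> : Phi (aZ h z) g = CB_act a h (Phi z (g * h)%g).
      by rewrite /Phi -actM -aZM invgM mulVKg.
    move=> [y Py <-]; exists y => //; rewrite HE.
    by apply: sub_closed_convex_hull; exists (g * h)%g.
  move=> g z; apply/CB_eq/seteqP; split; first exact: sub.
  (* The reverse inclusion is the same one for [g^-1] at [aZ g z], transported by [g]. *)
  move=> _ [x Hx <-]; have := sub g^-1%g (aZ g z).
  rewrite -aZM mulVg aZ1 => /(_ _ Hx)[y Hy <-].
  by rewrite bactVK.
- by move=> z; apply: (Qhull (Phi z)) => // g; exact/Qact.
- move=> z Fz; apply: CB_eq; rewrite HE -[RHS]closed_convex_hull_id.
  congr closed_convex_hull.
  have PhiE g : Phi z g = F z by rewrite /Phi Fz -actM mulVg act1.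
  apply/seteqP; split=> [x [g _]|x Fx]; first by rewrite PhiE.
  by exists 1%g => //; rewrite PhiE.
Qed.

End averaging.

(** * Equivariant extension within a class of sets *)

Section extension.
Context {G : topologicalGroupType} {R : realType} {L : completeNormedModType R}.
Hypothesis compactG : compact [set: G].
Variable a : banachGaction G L.

Lemma origin_CB_subproof :
  [/\ [set (0 : L)] !=set0, closed [set (0 : L)], bounded_set [set (0 : L)] &
      convex_set [set (0 : L)]].
Proof.
have c0 : compact [set (0 : L)] by exact: compact_set1.
split; [by exists 0 | | exact: compact_bounded | ].
  by apply: compact_closed c0; exact: norm_hausdorff.
by apply/convex_setP => _ _ k _ -> ->; rewrite !scaler0 addr0.
Qed.

(** A fixed point of the action: it gives the equivariant constant map when [A] is empty and a
    default value off [A]. *)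
Definition origin_CB : CB L := MkCB origin_CB_subproof.

Lemma CB_act_origin g : CB_act a g origin_CB = origin_CB.
Proof. by apply: CB_eq; rewrite /= image_set1 -[X in a g X](subrr 0) bactB subrr. Qed.

(** The class [Q], stable under every operation of the construction and with continuous orbit maps,
    treats [cc L] and [CB L] together. *)
Lemma equivariant_extension (Q : set (CB L)) (Z : topologicalType)
    (aZ : G -> Z -> Z) (A : set Z) (iA : Defs.invariant aZ A) (f : A -> CB L) :
  (forall B, Q B -> continuous (fun g => CB_act a g B)) ->
  (forall g B, Q B -> Q (CB_act a g B)) ->
  (forall t C D, Q C -> Q D -> Q (mix t C D)) ->
  (forall (Psi : G -> CB L) C, continuous Psi -> (forall g, Q (Psi g)) ->
    cb_set C = closed_convex_hull (\bigcup_g cb_set (Psi g)) -> Q C) ->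
  Q origin_CB ->
  metrizable R Z -> Gspace aZ -> closed A -> continuous f ->
  equivariant (restr_act iA) (CB_act a) f -> (forall x, Q (f x)) ->
  exists F : Z -> CB L,
    [/\ continuous F, equivariant aZ (CB_act a) F, forall z, Q (F z) &
        forall z : A, F (set_val z) = f z].
Proof.
move=> Qc Qact Qmix Qhull Q0 mZ aZP clA cf ef Qf.
have [A0|/set0P A0] := eqVneq A set0.
  exists (cst origin_CB); split=> //.
  - by move=> z; exact: cvg_cst.
  - by move=> g z; rewrite CB_act_origin.
  - by case=> z zA; exfalso; move: zA; rewrite A0 inE.
pose f' z := if pselect (A z) is left Az then f (SigSub (mem_set Az)) else origin_CB.
have f'E (z : A) : f' (set_val z) = f z.
  rewrite /f'; case: pselect => [Az|]; last by case; exact: set_valP.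
  by congr f; exact: val_inj.
have f'c : {within A, continuous f'}.
  by apply/subspace_sigL_continuousP; rewrite (_ : sigL A f' = f)//; apply/funext.
have Qf' z : Q (f' z) by rewrite /f'; case: pselect.
have [F [cF QF FE]] := dugundji_CB mZ clA A0 f'c Qmix Qf'.
have [H [cH eH QH HE]] := equivariant_hull compactG aZP cF QF Qc Qact Qhull.
exists H; split=> // z; rewrite -f'E -FE; last exact: set_valP.
apply: HE => g.
have -> : aZ g (set_val z) = set_val (restr_act iA g z) by [].
by rewrite !FE ?f'E ?ef//; exact: set_valP.
Qed.

End extension.

(** * The two hyperspaces as equivariant absolute extensors *)

Section hyperspaces.
Context {G : topologicalGroupType} {R : realType} {L : completeNormedModType R}.
Hypothesis compactG : compact [set: G].
Variable a : banachGaction G L.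

Lemma hausdorff_dist_eq0 (A B : CB L) : hausdorff_dist A B = 0 <-> A = B.
Proof.
by split=> [|->]; [exact: hausdorff_dist_positivity | exact: hausdorff_distxx].
Qed.

Lemma metrizable_CB : metrizable R (CB L).
Proof.
exists (fun A B : CB L => hausdorff_dist A B).
split; [exact: hausdorff_dist_eq0 | exact: hausdorff_dist_sym | | exact: nbhs_CBP].
by move=> A B C; exact: hausdorff_dist_triangle.
Qed.

Lemma nbhs_ccP (A : cc L) (U : set (cc L)) : nbhs A U <->
  exists2 e, 0 < e & forall B : cc L,
    hausdorff_dist (set_val A : CB L) (set_val B : CB L) < e -> U B.
Proof.
split=> [|[e e0 eU]].
  case=> _ /= [] [W oW <- /= WA WU].
  have /nbhs_CBP[e e0 eW] : nbhs (set_val A) W by exact: open_nbhs_nbhs.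
  by exists e => // B AB; apply: WU; exact: eW.
have nA := @initial_continuous (cc L) (CB L) set_val A _ (near_CB_lt (set_val A) e0).
by apply: (@filterS _ (nbhs A) _ _ _ _ nA) => B; exact: eU.
Qed.

Lemma metrizable_cc : metrizable R (cc L).
Proof.
exists (fun A B : cc L => hausdorff_dist (set_val A : CB L) (set_val B : CB L)).
split; last exact: nbhs_ccP.
- move=> A B; split=> [|->]; last exact: hausdorff_distxx.
  by move=> /hausdorff_dist_positivity/val_inj.
- by move=> A B; exact: hausdorff_dist_sym.
- by move=> A B C; exact: hausdorff_dist_triangle.
Qed.

Lemma continuous_ccP (T : topologicalType) (F : T -> cc L) :
  continuous (fun x => set_val (F x) : CB L) -> continuous F.
Proof.
move=> cF x U /nbhs_ccP[e e0 eU].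
by apply: (@filterS _ (nbhs x) _ _ _ _ (cF x _ (near_CB_lt _ e0))) => y; exact: eU.
Qed.

Lemma cc_act_Gspace : Gspace (cc_act a).
Proof.
have [act1 actM] := CB_act_is_action a; split.
  by split=> [A|g h A]; apply: val_inj; [exact: act1 | exact: actM].
apply: continuous_ccP => -[g A].
apply: (@CB_act_cvg _ _ _ a _ (nbhs (g, A)) _ fst
  (fun p : G * cc L => set_val p.2 : CB L)).
- by apply: compact_CB_act_continuous; exact: (set_valP A).
- exact: cvg_fst.
- apply: (@cvg_comp _ _ _ snd (fun B : cc L => set_val B : CB L) _ (nbhs A)).
    exact: cvg_snd.
  exact: initial_continuous.
Qed.

Lemma cc_G_AE : G_AE R (cc_act a).
Proof.
split; [exact: metrizable_cc | exact: cc_act_Gspace |].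
move=> Z aZ mZ aZP A iA f clA cf ef.
have [||||||||F [cF eF QF FE]] :=
  @equivariant_extension _ _ _ compactG a (cc L) Z aZ A iA
    (fun x => set_val (f x)) _ _ _ _ _ mZ aZP clA.
- by move=> B cB; exact: compact_CB_act_continuous.
- by move=> g B; exact: cc_invariant.
- by move=> t C D; exact: compact_mix.
- move=> Psi C cPsi Psi_compact CE; rewrite /cc /= CE.
  exact: compact_closed_convex_hull_family.
- exact: compact_set1.
- by move=> x; apply: cvg_comp (cf x) _; exact: initial_continuous.
- by move=> g x; rewrite ef.
- by move=> x; exact: set_valP.
exists (fun z => SigSub (mem_set (QF z))); split.
- exact: continuous_ccP.
- by move=> g z; apply: val_inj; exact: eF.
- by move=> z; apply: val_inj; exact: FE.
Qed.

Lemma CB_G_AE : continuous_action (CB_act a) -> G_AE R (CB_act a).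
Proof.
move=> ca; split; [exact: metrizable_CB | by split; [exact: CB_act_is_action|] |].
move=> Z aZ mZ aZP A iA f clA cf ef.
have [|//|//|//|//|F [cF eF _ FE]] :=
  @equivariant_extension _ _ _ compactG a setT Z aZ A iA
    f _ _ _ _ _ mZ aZP clA cf ef (fun _ => I); last by exists F.
(* With [setT] as class, the remaining condition is continuity of orbit maps, which are restrictions
   of the jointly continuous action. *)
move=> B _ g; apply: (continuous_comp (f := fun g : G => (g, B))
  (g := fun p : G * CB L => CB_act a p.1 p.2)); last exact: ca.
by apply: (@cvg_pair _ _ _ (nbhs g) (nbhs g) (nbhs B)); [exact: cvg_id | exact: cvg_cst].
Qed.

End hyperspaces.

Theorem theorem5p1 (R : realType) (G : topologicalGroupType)
    (compactG : compact [set: G]) (L : completeNormedModType R)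
    (a : banachGaction G L) :
  G_AE R (cc_act a) /\
  (continuous_action (CB_act a) -> G_AE R (CB_act a)).
Proof. by split; [exact: cc_G_AE | exact: CB_G_AE]. Qed.
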